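(* Let $\pi = \{I_1,\ldots,I_m\}$ be a partition of $\{1,\ldots,N\}$, where $N\ge1$. If the matrix $A\in\overline{\mathcal{S}_\pi}$, then the compression $\Theta^\downarrow_\pi(A)$ has the same spectrum and singular values as $A$, with the possible exception of the value zero.
   Context: $\overline{\mathcal{S}_\pi}$ is the closure of the set $\mathcal{S}_\pi$ of matrices $A\in\mathbb{C}^{N\times N}$ for which $\pi$ is the coarsest partition such that $A$ is constant on each block $I_i\times I_j$; equivalently, $\overline{\mathcal{S}_\pi}$ is the set of all $A\in\mathbb{C}^{N\times N}$ constant on each block $I_i\times I_j$. The matrix $\mathcal{W}_\pi\in\mathbb{C}^{N\times m}$ has $(i,j)$ entry $1$ if $i\in I_j$ and $0$ otherwise, $D_\pi := \operatorname{diag}(|I_1|,\ldots,|I_m|)$, and $\Theta^\downarrow_\pi(A) := D_\pi^{-1/2}\mathcal{W}_\pi^*A\mathcal{W}_\pi D_\pi^{-1/2}\in\mathbb{C}^{m\times m}$. The spectrum is the set of eigenvalues, and the singular values of $A$ are the eigenvalues of $|A| = \sqrt{A^*A}$. *)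

(* Defs.v *)
From HB Require Import structures.
From mathcomp Require Import all_boot all_order all_algebra.
From mathcomp Require Import all_classical all_reals.
From mathcomp Require Import topology normedtype.
From mathcomp Require Export complex.

Set Implicit Arguments.
Unset Strict Implicit.
Unset Printing Implicit Defensive.

Import Order.TTheory GRing.Theory Num.Theory numFieldNormedType.Exports.
Local Open Scope sesquilinear_scope.
Local Open Scope classical_set_scope.
Local Open Scope ring_scope.

(* The partition {I_0, ..., I_(m-1)} of 'I_N is given as an enumeration of its
   m blocks without repetition. *)
Definition is_partition (N m : nat) (I : 'I_m -> {set 'I_N}) : Prop :=
  injective I /\
    finset.partition [set I j | j : 'I_m]%SET [set: 'I_N]%SET.

Definition block_constant (K : numClosedFieldType) (N m : nat)
    (I : 'I_m -> {set 'I_N}) (A : 'M[K]_N) : Prop :=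
  forall (k l : 'I_m) (i i' j j' : 'I_N),
    i \in I k -> i' \in I k -> j \in I l -> j' \in I l -> A i j = A i' j'.

(* J is finer than I. *)
Definition refines (N p m : nat)
    (J : 'I_p -> {set 'I_N}) (I : 'I_m -> {set 'I_N}) : Prop :=
  forall k : 'I_p, exists l : 'I_m, J k \subset I l.

(* The matrices for which I is the coarsest partition on whose blocks they are
   constant. *)
Definition stratum (K : numClosedFieldType) (N m : nat)
    (I : 'I_m -> {set 'I_N}) : set 'M[K]_N :=
  [set A | block_constant I A /\
     forall (p : nat) (J : 'I_p -> {set 'I_N}),
       is_partition J -> block_constant J A -> refines J I].

Definition closed_stratum (K : numClosedFieldType) (N m : nat)
    (I : 'I_m -> {set 'I_N}) : set 'M[K]_N :=
  closure (stratum I).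

Definition incidence_mx (K : numClosedFieldType) (N m : nat)
    (I : 'I_m -> {set 'I_N}) : 'M[K]_(N, m) :=
  \matrix_(i < N, j < m) (i \in I j)%:R.

(* The power D^(-1/2) of D = diag(|I_0|, ..., |I_(m-1)|). *)
Definition block_size_invsqrt (K : numClosedFieldType) (N m : nat)
    (I : 'I_m -> {set 'I_N}) : 'M[K]_m :=
  diag_mx (\row_j (sqrtC (#|I j|%:R : K))^-1).

Definition compression (K : numClosedFieldType) (N m : nat)
    (I : 'I_m -> {set 'I_N}) (A : 'M[K]_N) : 'M[K]_m :=
  block_size_invsqrt K I *m (incidence_mx K I)^t* *m A
    *m incidence_mx K I *m block_size_invsqrt K I.

Definition spectrum (K : numClosedFieldType) (n : nat) (A : 'M[K]_n) : set K :=
  [set z | eigenvalue A z].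

(* 0 <= z in K means that z is real and nonnegative, so psdmx A forces A to be
   Hermitian. *)
Definition psdmx (K : numClosedFieldType) (n : nat) (A : 'M[K]_n) : Prop :=
  forall x : 'cV[K]_n, 0 <= (x^t* *m A *m x) 0 0.

(* The default value 0 is only used when A has no positive semidefinite square
   root; absmxP shows that this never happens for A^t* *m A. *)
Definition sqrtmx (K : numClosedFieldType) (n : nat) (A : 'M[K]_n) : 'M[K]_n :=
  xget 0 [set B | psdmx B /\ B *m B = A].

Definition absmx (K : numClosedFieldType) (n : nat) (A : 'M[K]_n) : 'M[K]_n :=
  sqrtmx (A^t* *m A).

Definition singular_values (K : numClosedFieldType) (n : nat) (A : 'M[K]_n) :
    set K :=
  spectrum (absmx A).

(* The closure is taken in the norm topology of the matrices over K. *)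
Lemma closed_stratumP (K : numClosedFieldType) (N m : nat)
    (I : 'I_m -> {set 'I_N}) (A : 'M[K]_N) :
  is_partition I -> closed_stratum I A <-> block_constant I A.
Proof.
move=> [injI partI].
have inI i : exists k, i \in I k.
  have : i \in finset.cover [set I j | j : 'I_m]%SET.
    by rewrite (finset.cover_partition partI) finset.inE.
  by move=> /finset.bigcupP[B /imsetP[k _ ->]]; exists k.
have uniqI i k l : i \in I k -> i \in I l -> k = l.
  move=> ik il; apply: injI.
  have /and3P[_ trI _] := partI.
  by rewrite -(def_pblock trI _ ik) ?imset_f // -(def_pblock trI _ il) ?imset_f.
split=> [clA k l i i' j j' ik ik' jl jl'|cA].
  apply: contrapT => /eqP neqA.
  have e0 : 0 < `|A i j - A i' j'| / 2 by rewrite divr_gt0 ?normr_gt0 ?subr_eq0.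
  have /clA[B [[cB _] /= [_ bB]]] := nbhsx_ballx A _ e0.
  have h1 : `|A i j - B i j| < `|A i j - A i' j'| / 2 by apply: bB.
  have h2 : `|B i j - A i' j'| < `|A i j - A i' j'| / 2.
    by rewrite (cB _ _ _ _ _ _ ik ik' jl jl') distrC; apply: bB.
  have := le_lt_trans (ler_distD (B i j) (A i j) (A i' j')) (ltrD h1 h2).
  by rewrite -splitr ltxx.
move=> U /nbhs_ballP[e /= e0 eU].
pose t := (e^-1 + 1 + \sum_i \sum_j `|A i j - A j j|^-1)^-1.
have s0 : 0 <= \sum_i \sum_j `|A i j - A j j|^-1.
  by do 2![apply: sumr_ge0 => ? _]; rewrite invr_ge0.
have t1 : 0 < e^-1 + 1 + \sum_i \sum_j `|A i j - A j j|^-1.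
  by rewrite ltr_wpDr // addr_gt0 // invr_gt0.
have t0 : 0 < t by rewrite invr_gt0.
have te : t < e.
  rewrite -[e]invrK ltf_pV2 ?posrE ?invr_gt0 // -addrA ltrDl.
  by rewrite ltr_wpDr.
have tA i j : A i j - A j j != t.
  apply/negP => /eqP Et.
  have /eqP : `|A i j - A j j|^-1 = t^-1 by rewrite Et gtr0_norm.
  apply/negP; rewrite lt_eqF // /t invrK.
  rewrite ltr_pwDl ?addr_gt0 ?invr_gt0 //.
  rewrite (bigD1 i) //= (bigD1 j) //= -addrA lerDl addr_ge0 //.
    by apply: sumr_ge0 => ? _; rewrite invr_ge0.
  by do 2![apply: sumr_ge0 => ? _]; rewrite invr_ge0.
pose E := \matrix_(i, j) (t * [exists k, (i \in I k) && (j \in I k)]%:R) : 'M[K]_N.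
exists (A + E); split; last first.
  apply: eU; split=> // i j; rewrite /ball /= !mxE opprD addrA subrr sub0r normrN.
  case: [exists _, _]; last by rewrite mulr0 normr0.
  by rewrite mulr1 gtr0_norm.
split=> [k l i i' j j' ik ik' jl jl'|p J [_ partJ] cJ k].
  rewrite !mxE (cA _ _ _ _ _ _ ik ik' jl jl'); congr (_ + t * _%:R).
  have inE x x' q r : x \in I r -> x' \in I r -> (x \in I q) = (x' \in I q).
    by move=> xr x'r; apply/idP/idP => [xq|x'q];
      [rewrite (uniqI _ _ _ xq xr)|rewrite (uniqI _ _ _ x'q x'r)].
  by congr nat_of_bool; apply: eq_existsb => q;
    rewrite (inE _ _ _ _ ik ik') (inE _ _ _ _ jl jl').
have [i ik] : exists i, i \in J k.
  apply/finset.set0Pn/negP => /eqP J0; have /and3P[_ _ /negP] := partJ; apply.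
  by rewrite -J0 imset_f.
have [l il] := inI i; exists l; apply/fintype.subsetP => j jk.
apply: contrapT => jl.
have := cJ k k i j j j ik jk jk jk; rewrite !mxE.
have -> : [exists q, (i \in I q) && (j \in I q)] = false.
  apply/existsP => -[q /andP[iq jq]]; apply: jl.
  by rewrite -(uniqI _ _ _ iq il).
have -> : [exists q, (j \in I q) && (j \in I q)].
  by have [q jq] := inI j; apply/existsP; exists q; rewrite jq.
by rewrite mulr0 mulr1 addr0 => /eqP; rewrite addrC -subr_eq (negPf (tA _ _)).
Qed.

Lemma absmxP (K : numClosedFieldType) (n : nat) (A : 'M[K]_n) :
  psdmx (absmx A) /\ absmx A *m absmx A = A^t* *m A.
Proof.
pose S := A^t* *m A; pose U := spectralmx S; pose d := spectral_diag S.
have UU : U *m U^t* = 1%:M by apply/unitarymxP/spectral_unitarymx.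
have UU' : U^t* *m U = 1%:M by apply: mulmx1C.
have adjM p q r (X : 'M[K]_(p, q)) (Y : 'M_(q, r)) :
  (X *m Y)^t* = Y^t* *m X^t* by rewrite trmx_mul map_mxM.
have sqE p (x : 'cV[K]_p) : 0 <= (x^t* *m x) 0 0.
  rewrite mxE; apply: sumr_ge0 => i _.
  by rewrite !mxE mulrC mul_conjC_ge0.
have SE : S = U^t* *m diag_mx d *m U.
  have /orthomx_spectralP : S \is normalmx.
    by apply: hermitian_normalmx; rewrite is_hermitianmxE expr0 scale1r
       adjM trmxCK.
  by rewrite invmx_unitary ?spectral_unitarymx.
have d0 i : 0 <= d 0 i.
  have -> : d 0 i = ((col i (A *m U^t*))^t* *m col i (A *m U^t*)) 0 0.
    have -> : d 0 i = (U *m S *m U^t*) i i.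
      rewrite SE !mulmxA UU mul1mx -mulmxA UU mulmx1.
      by rewrite mxE eqxx mulr1n.
    rewrite /S mulmxA -(trmxCK U) -adjM trmxCK -mulmxA !mxE.
    by apply: eq_bigr => j _; rewrite !mxE.
  exact: sqE.
pose B := U^t* *m diag_mx (map_mx sqrtC d) *m U.
suff : [set C | psdmx C /\ C *m C = S] (absmx A) by [].
rewrite /absmx /sqrtmx; apply: xgetPex; exists B; split=> [x|].
  have -> : x^t* *m B *m x = (U *m x)^t* *m diag_mx (map_mx sqrtC d) *m (U *m x).
    by rewrite adjM /B !mulmxA.
  rewrite mxE; apply: sumr_ge0 => i _.
  rewrite mul_mx_diag !mxE mulrAC mulr_ge0 ?sqrtC_ge0 // mulrC.
  exact: mul_conjC_ge0.
rewrite /B !mulmxA -(mulmxA _ U) UU mulmx1 -(mulmxA _ _ (diag_mx _)) mulmx_diag.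
rewrite -/S SE; congr (_ *m diag_mx _ *m _).
by apply/rowP => i; rewrite !mxE -expr2 sqrtCK.
Qed.

(* Main.v *)
Require Import Defs.
From mathcomp Require Import all_boot all_order all_algebra.
From mathcomp Require Import all_classical all_reals.

(** The columns of [V = W D^(-1/2)], where [W] is the incidence matrix and [D]
    the diagonal matrix of block sizes, are the normalized indicators of the
    blocks. The blocks are disjoint and nonempty, so [V] is an isometry
    ([V^t* V = 1]), and [V V^t*] replaces every entry of a vector by its mean
    over the block ([block_isometry_projK]). It therefore fixes the matrices
    that are constant on blocks, on either side, and such a matrix factors
    through its compression [C = V^t* A V] as [A = V C V^t*]
    ([block_constant_dilation]).

    The nonzero eigenvalues of [V C W] and [C] agree whenever [W V = 1]
    ([eigenvalue_dilation]): [W] and [V] exchange the eigenvectors. That is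
    the claim on spectra. For singular values, [A^t* A = V (C^t* C) V^t*] is
    again a dilation, so [A^t* A] and [C^t* C] have the same nonzero
    eigenvalues, and [z] is an eigenvalue of the positive semidefinite root of
    [S] iff [0 <= z] and [z ^+ 2] is an eigenvalue of [S]
    ([eigenvalue_psd_root]). This characterization mentions only [S], so it
    carries the equality of the eigenvalues of [A^t* A] and [C^t* C] over to
    their roots. *)

Set Implicit Arguments.
Unset Strict Implicit.
Unset Printing Implicit Defensive.

Import Order.TTheory GRing.Theory Num.Theory.
Local Open Scope sesquilinear_scope.
Local Open Scope complex_scope.
Local Open Scope classical_set_scope.
Local Open Scope ring_scope.

(** If [v] is an eigenvector of [V C W], then [v V] is one of [C]; it is
    nonzero because [v V C W = z v] and [z != 0]. Conversely an eigenvector [u]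
    of [C] gives [u W], nonzero because [u W V = u]. *)
Lemma eigenvalue_dilation (F : fieldType) (n m : nat) (V : 'M[F]_(n, m))
    (W : 'M[F]_(m, n)) (C : 'M[F]_m) (z : F) :
  W *m V = 1%:M -> z != 0 -> eigenvalue (V *m C *m W) z = eigenvalue C z.
Proof.
move=> WV z0; apply/eigenvalueP/eigenvalueP => -[v vE v0].
- exists (v *m V); first by rewrite -[LHS]mulmx1 -WV scalemxAl -vE !mulmxA.
  apply: contra_neq v0 => vV0; apply: (scalerI z0).
  by rewrite -vE !mulmxA vV0 !mul0mx scaler0.
- exists (v *m W); first by rewrite !mulmxA -(mulmxA v) WV mulmx1 vE -scalemxAl.
  apply: contra_neq v0 => vW0.
  by rewrite -[v]mulmx1 -WV mulmxA vW0 mul0mx.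
Qed.

Lemma trmxC_mul (K : numClosedFieldType) (n p q : nat) (X : 'M[K]_(n, p))
    (Y : 'M[K]_(p, q)) : (X *m Y)^t* = Y^t* *m X^t*.
Proof. by rewrite trmx_mul map_mxM. Qed.

Section PsdSquareRoot.
Variable K : numClosedFieldType.

Lemma row_sqnorm_gt0 (n : nat) (v : 'rV[K]_n) :
  v != 0 -> 0 < (v *m v^t*) 0 0.
Proof.
move=> v0; have [j vj0] : exists j, v 0 j != 0.
  apply/existsP; apply: contra_neqT v0; rewrite negb_exists => /forallP v0.
  by apply/rowP => j; rewrite mxE; apply/eqP/negPn/v0.
rewrite mxE (bigD1 j) //= !mxE ltr_wpDr ?mul_conjC_gt0 //.
by apply: sumr_ge0 => k _; rewrite !mxE mul_conjC_ge0.
Qed.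

Lemma psdmx_eigenvalue_ge0 (n : nat) (B : 'M[K]_n) (z : K) :
  psdmx B -> eigenvalue B z -> 0 <= z.
Proof.
move=> psdB /eigenvalueP[v vB v0]; have := psdB (v^t*).
by rewrite trmxCK vB -scalemxAl mxE pmulr_lge0 ?row_sqnorm_gt0.
Qed.

(** If [v] is an eigenvector of [B ^+ 2] for [z ^+ 2], then [w = v (B - z)]
    satisfies [w B = - z w]. Either [w = 0] and [v] is the required
    eigenvector, or [- z] is an eigenvalue of [B]; positivity then forces
    [z = 0]. *)
Lemma eigenvalue_psd_root (n : nat) (B S : 'M[K]_n) (z : K) :
  psdmx B -> B *m B = S -> eigenvalue B z = (0 <= z) && eigenvalue S (z ^+ 2).
Proof.
move=> psdB <-; apply/idP/andP => [eBz|[z0 /eigenvalueP[v vBB v0]]].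
  split; first exact: psdmx_eigenvalue_ge0 eBz.
  have /eigenvalueP[v vB v0] := eBz; apply/eigenvalueP; exists v => //.
  by rewrite mulmxA vB -scalemxAl vB scalerA.
have [w0|w0] := eqVneq (v *m B - z *: v) 0.
  by apply/eigenvalueP; exists v => //; apply/subr0_eq.
have eBNz : eigenvalue B (- z).
  apply/eigenvalueP; exists (v *m B - z *: v) => //.
  rewrite mulmxBl -mulmxA vBB -scalemxAl.
  by rewrite scaleNr scalerBr scalerA -expr2 opprB.
have zE : z = - z.
  have := psdmx_eigenvalue_ge0 psdB eBNz; rewrite oppr_ge0 => z_le0.
  by have -> : z = 0 by [apply/le_anti; rewrite z_le0]; rewrite oppr0.
by rewrite zE.
Qed.

Lemma singular_valuesE (n : nat) (A : 'M[K]_n) :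
  singular_values A =
    [set z | (0 <= z) && eigenvalue (A^t* *m A) (z ^+ 2)].
Proof.
have [psdA sqA] := absmxP A.
by apply/seteqP; split=> z; rewrite /singular_values /spectrum /=
  (eigenvalue_psd_root _ psdA sqA).
Qed.

End PsdSquareRoot.

Section BlockIsometry.
Variables (K : numClosedFieldType) (N m : nat) (I : 'I_m -> {set 'I_N}).
Hypothesis partI : is_partition I.

Definition block_isometry : 'M[K]_(N, m) :=
  incidence_mx K I *m block_size_invsqrt K I.

Local Notation V := block_isometry.

Lemma block_isometryE i k :
  V i k = (i \in I k)%:R * (sqrtC (#|I k|%:R : K))^-1.
Proof. by rewrite /block_isometry /block_size_invsqrt mul_mx_diag !mxE. Qed.

Lemma block_isometry_conjE k i : V^t* k i = V i k.
Proof.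
rewrite 2!mxE block_isometryE; apply: geC0_conj.
by rewrite mulr_ge0 ?invr_ge0 ?sqrtC_ge0 ?ler0n.
Qed.

Lemma block_isometry_adjE :
  V^t* = block_size_invsqrt K I *m (incidence_mx K I)^t*.
Proof.
apply/matrixP => k i; rewrite block_isometry_conjE block_isometryE.
by rewrite /block_size_invsqrt mul_diag_mx !mxE conjC_nat mulrC.
Qed.

Lemma compressionE (A : 'M[K]_N) : compression I A = V^t* *m A *m V.
Proof. by rewrite block_isometry_adjE /compression !mulmxA. Qed.

Lemma block_exists i : exists k, i \in I k.
Proof.
have [_ pI] := partI.
have : i \in finset.cover [set I j | j : 'I_m]%SET.
  by rewrite (finset.cover_partition pI) finset.inE.
by move=> /finset.bigcupP[B /imsetP[k _ ->]]; exists k.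
Qed.

Lemma block_unique i k l : i \in I k -> i \in I l -> k = l.
Proof.
have [injI /and3P[_ trI _]] := partI => ik il; apply: injI.
by rewrite -(def_pblock trI _ ik) ?imset_f // -(def_pblock trI _ il) ?imset_f.
Qed.

Lemma block_size_neq0 k : (#|I k|%:R : K) != 0.
Proof.
have [_ /and3P[_ _ n0]] := partI.
rewrite pnatr_eq0 cards_eq0; apply: contraNneq n0 => <-.
exact: imset_f.
Qed.

Lemma block_sqrtK k :
  (sqrtC (#|I k|%:R : K))^-1 * (sqrtC (#|I k|%:R : K))^-1 = #|I k|%:R^-1.
Proof. by rewrite -invfM -expr2 sqrtCK. Qed.

Lemma block_isometryP : V^t* *m V = 1%:M.
Proof.
apply/matrixP => k l; rewrite mxE [RHS]mxE.
under eq_bigr => i _ do rewrite block_isometry_conjE !block_isometryE.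
have [<-|kl] := eqVneq k l.
  under eq_bigr => i _ do
    rewrite mulrACA block_sqrtK -natrM mulnb andbb mulr_natl mulrb.
  rewrite -big_mkcond /= sumr_const -(mulr_natr (_^-1)).
  by rewrite mulVf // block_size_neq0.
rewrite big1 // => i _; rewrite mulrACA -natrM mulnb.
case: andP => [[ik il]|]; last by rewrite mul0r.
by rewrite (block_unique ik il) eqxx in kl.
Qed.

(** [V V^t*] averages over the blocks, so a matrix whose rows are equal
    within each block is left unchanged. *)
Lemma block_isometry_projK (p : nat) (X : 'M[K]_(N, p)) :
  (forall k i i' j, i \in I k -> i' \in I k -> X i j = X i' j) ->
  V *m (V^t* *m X) = X.
Proof.
move=> cX; apply/matrixP => i j; have [k ik] := block_exists i.
(* Only the block of i contributes to the outer sum. *)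
rewrite mxE (bigD1 k) //= [X in _ + X]big1 => [|l lk]; last first.
  rewrite block_isometryE; case: (boolP (i \in I l)) => [il|_].
    by rewrite (block_unique il ik) eqxx in lk.
  by rewrite !mul0r.
rewrite addr0 block_isometryE ik mul1r mxE.
have -> : \sum_l V^t* k l * X l j =
    #|I k|%:R * ((sqrtC (#|I k|%:R : K))^-1 * X i j).
  rewrite mulr_natl -sumr_const [RHS]big_mkcond /=; apply: eq_bigr => l _.
  rewrite block_isometry_conjE block_isometryE.
  by case: ifP => lk; rewrite ?mul0r // mul1r (cX k l i j lk ik).
by rewrite mulrCA (mulrA (_^-1)) block_sqrtK mulVKf ?block_size_neq0.
Qed.

Lemma block_constant_dilation (A : 'M[K]_N) :
  block_constant I A -> A = V *m compression I A *m V^t*.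
Proof.
move=> cA.
have VA : V *m (V^t* *m A) = A.
  apply: block_isometry_projK => k i i' j ik i'k.
  by have [l jl] := block_exists j; exact: (cA _ _ _ _ _ _ ik i'k jl jl).
(* Constancy along columns is constancy along the rows of the adjoint. *)
have AV : A *m V *m V^t* = A.
  rewrite -[RHS]trmxCK -(block_isometry_projK (X := A^t*)).
    by rewrite (trmxC_mul V) (trmxC_mul (V^t*)) !trmxCK.
  move=> k i i' j ik i'k; rewrite !mxE.
  have [l jl] := block_exists j; congr (_ ^*).
  exact: (cA _ _ _ _ _ _ jl jl ik i'k).
by rewrite -{1}AV -{1}VA compressionE (mulmxA V _ V).
Qed.

End BlockIsometry.

Lemma gram_dilation (K : numClosedFieldType) (N m : nat) (V : 'M[K]_(N, m))
    (C : 'M[K]_m) :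
  V^t* *m V = 1%:M ->
  (V *m C *m V^t*)^t* *m (V *m C *m V^t*) = V *m (C^t* *m C) *m V^t*.
Proof.
move=> VV; rewrite !trmxC_mul trmxCK !mulmxA.
by rewrite -(mulmxA _ (V^t*) V) VV mulmx1.
Qed.

Theorem proposition6p7 (R : realType) (N m : nat) (hN : (1 <= N)%N)
    (I : 'I_m -> {set 'I_N}) (hI : is_partition I)
    (A : 'M[R[i]]_N) (hA : closed_stratum I A) :
  spectrum (compression I A) `\` [set 0] = spectrum A `\` [set 0] /\
  singular_values (compression I A) `\` [set 0] =
    singular_values A `\` [set 0].
Proof.
have /(closed_stratumP _ hI) cA := hA.
have VV := block_isometryP R[i] hI.
have AE := block_constant_dilation hI cA.
rewrite !singular_valuesE.
move: (compression I A) AE => C ->; rewrite gram_dilation //.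
by split; apply/seteqP; split=> z /= [zP /eqP z0]; split; try exact/eqP;
  move: zP; rewrite /spectrum /= eigenvalue_dilation ?expf_neq0.
Qed.
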